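(* Assuming $\exists^2$, the combination $\Delta+M_{\mathsf{BV}}$ computes $\Omega$.
   Context: Computability is Kleene's higher-order computability (S1–S9), extended to partial functionals; $\exists^2:\mathbb{N}^{\mathbb{N}}\to\{0,1\}$ satisfies $\exists^2(g)=0\leftrightarrow(\exists n)(g(n)=0)$. Sets of reals are given by characteristic functions. $O\subseteq[0,1]$ is R2-open if there is $Y:\mathbb{R}\to\mathbb{R}$ (an R2-representation) such that for all $x$: $x\in O$ implies $Y(x)>0$ and $B(x,Y(x))\subseteq O$, and $Y(x)=0$ implies $x\notin O$. An RM-code for an open set $O$ is a pair of real sequences $(a_n),(b_n)$ with $O=\bigcup_n(a_n,b_n)$. $\Delta$ is a functional such that for any R2-open $O\subseteq[0,1]$ with R2-representation, $\Delta$ applied to it together with $\exists^2$ computes an RM-code for $O$. $\Omega$ is defined on sets $X$ with at most one element, outputting the element if $|X|=1$ and $0$ if $X=\emptyset$. For $f:[0,1]\to\mathbb{R}$ with nonempty set $C_f$ of continuity points, a modulus of continuity is $F:\mathbb{R}\times\mathbb{N}\to\mathbb{N}$ such that for all $k$, $x\in C_f$, $y\in[0,1]$: $|x-y|<2^{-F(x,k)}\Rightarrow|f(x)-f(y)|<2^{-k}$. $M_{\mathsf{BV}}$ outputs, on input $f:[0,1]\to\mathbb{R}$ of bounded variation, a modulus of continuity for $f$. *)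

(* Defs.v *)
From HB Require Import structures.
From mathcomp Require Import all_boot all_order all_algebra.
From mathcomp Require Import all_classical all_reals all_analysis.

Set Implicit Arguments.
Unset Strict Implicit.
Unset Printing Implicit Defensive.

Import Order.TTheory GRing.Theory Num.Theory.
Import numFieldNormedType.Exports.

Local Open Scope classical_set_scope.

(** * Kleene's schemes S1-S9 with partial functionals as arguments *)

Inductive ty : Type := Base | Arr of ty & ty.

Notation "s ~~> t" := (Arr s t) (at level 55, right associativity).

Fixpoint total_obj (t : ty) : Type :=
  match t with Base => nat | s ~~> u => total_obj s -> total_obj u end.

(* A partial functional takes total objects as arguments, and whether it is
   defined is decided only once it has received all of them. *)
Fixpoint partial_obj (t : ty) : Type :=
  match t with Base => option nat | s ~~> u => total_obj s -> partial_obj u end.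

(* What may occur in an argument list: numbers, and partial functionals of
   higher type. *)
Definition arg (t : ty) : Type :=
  match t with Base => nat | s ~~> u => total_obj s -> partial_obj u end.

Fixpoint partial_of_total (t : ty) : total_obj t -> partial_obj t :=
  match t with
  | Base => fun n => Some n
  | s ~~> u => fun f x => partial_of_total (f x)
  end.

Definition arg_of_total (t : ty) : total_obj t -> arg t :=
  match t with
  | Base => fun n => n
  | s ~~> u => fun f => @partial_of_total (s ~~> u) f
  end.

Definition args := seq {t : ty & arg t}.
Definition parg (t : ty) (x : arg t) : {t : ty & arg t} := existT arg t x.
Definition targ (t : ty) (x : total_obj t) : {t : ty & arg t} :=
  parg (arg_of_total x).
Definition narg (n : nat) : {t : ty & arg t} := @targ Base n.

(* Indices are Goedel numbers of sequences of numbers starting with the number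
   of the scheme; CodeSeq.code is a bijection from seq nat to nat. *)
Definition idx (s : seq nat) : nat := CodeSeq.code s.

(* [kleene e a n] is {e}(a) ~ n.  Kleene's schemes are stated for pure types
   and record the types of the arguments in the index; here argument types are
   arbitrary finite types, which the argument list carries, so the indices
   omit them.  Accordingly S6 moves an argument of any type to the front, and
   S8 evaluates a functional of any finite type, with one index for each of its
   arguments.
   [ktotal d a g]: the function xi_1, ..., xi_k |-> {d}(xi_k, ..., xi_1, a) is
   total, and equal to g.
   [kapply phi ds a n]: phi is defined, with value n, at the total objects that
   the indices ds compute in this sense from a. *)
Inductive kleene : nat -> args -> nat -> Prop :=
| kleene_S1 (x : nat) (a : args) :
    kleene (idx [:: 1]) (narg x :: a) x.+1
| kleene_S2 (q : nat) (a : args) :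
    kleene (idx [:: 2; q]) a q
| kleene_S3 (x : nat) (a : args) :
    kleene (idx [:: 3]) (narg x :: a) x
| kleene_S4 (g h : nat) (a : args) (m n : nat) :
    kleene h a m -> kleene g (narg m :: a) n ->
    kleene (idx [:: 4; g; h]) a n
| kleene_S5_0 (g h : nat) (a : args) (n : nat) :
    kleene g a n ->
    kleene (idx [:: 5; g; h]) (narg 0 :: a) n
| kleene_S5_S (g h x : nat) (a : args) (m n : nat) :
    kleene (idx [:: 5; g; h]) (narg x :: a) m ->
    kleene h (narg x :: narg m :: a) n ->
    kleene (idx [:: 5; g; h]) (narg x.+1 :: a) n
| kleene_S6 (g : nat) (a1 a2 : args) (x : {t : ty & arg t}) (n : nat) :
    kleene g (x :: a1 ++ a2) n ->
    kleene (idx [:: 6; size a1; g]) (a1 ++ x :: a2) n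
| kleene_S7 (f : arg (Base ~~> Base)) (x : nat) (a : args) (n : nat) :
    f x = Some n ->
    kleene (idx [:: 7]) (parg f :: narg x :: a) n
| kleene_S8 (ds : seq nat) (s t : ty) (phi : arg (s ~~> t)) (a : args)
    (n : nat) :
    @kapply (s ~~> t) phi ds (parg phi :: a) n ->
    kleene (idx (8 :: ds)) (parg phi :: a) n
| kleene_S9 (x : nat) (a1 a2 : args) (n : nat) :
    kleene x a1 n ->
    kleene (idx [:: 9; size a1]) (narg x :: a1 ++ a2) n
with kapply : forall t : ty, partial_obj t -> seq nat -> args -> nat -> Prop :=
| kapply_nil (a : args) (n : nat) :
    @kapply Base (Some n) [::] a n
| kapply_cons (s t : ty) (phi : partial_obj (s ~~> t)) (d : nat) (ds : seq nat)
    (a : args) (g : total_obj s) (n : nat) :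
    @ktotal s d a g -> @kapply t (phi g) ds a n ->
    @kapply (s ~~> t) phi (d :: ds) a n
with ktotal : forall t : ty, nat -> args -> total_obj t -> Prop :=
| ktotal_Base (d : nat) (a : args) (n : nat) :
    kleene d a n -> @ktotal Base d a n
| ktotal_Arr (s t : ty) (d : nat) (a : args) (g : total_obj (s ~~> t)) :
    (forall xi : total_obj s, @ktotal t d (targ xi :: a) (g xi)) ->
    @ktotal (s ~~> t) d a g.

Local Open Scope ring_scope.

(** * Objects of analysis as objects of finite type *)

Notation ty1 := (Base ~~> Base).
Notation ty2 := (ty1 ~~> Base).
(* N^N -> N^N is curried to N^N -> N -> N *)
Notation tyRR := (ty1 ~~> ty1).

Definition E2 : total_obj ty2 :=
  fun g => if `[< exists n, g n = 0%N >] then 0%N else 1%N.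

(* every rational is (i - j) / (k + 1) for n = 2^i 3^j 5^k with suitable
   i, j, k *)
Definition rat_of_code (R : realType) (n : nat) : R :=
  ((logn 2%N n)%:R - (logn 3%N n)%:R) / (logn 5%N n).+1%:R.

Definition represents (R : realType) (alpha : total_obj ty1) (x : R) : Prop :=
  (forall n i : nat,
     `|rat_of_code R (alpha n) - rat_of_code R (alpha (n + i)%N)| < 2 ^- n) /\
  rat_of_code R (alpha n) @[n --> \oo] --> x.

Definition represents_fun (R : realType) (A : set R) (phi : total_obj tyRR)
    (f : R -> R) : Prop :=
  forall alpha x, represents alpha x -> A x -> represents (phi alpha) (f x).

Definition represents_set (R : realType) (chi : total_obj ty2)
    (X : set R) : Prop :=
  forall alpha x, represents alpha x ->
    (X x -> chi alpha = 1%N) /\ (~ X x -> chi alpha = 0%N).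

(** * The functionals *)

Definition R2_representation (R : realType) (O : set R) (Y : R -> R) : Prop :=
  forall x, (O x -> 0 < Y x /\ ball x (Y x) `<=` O) /\ (Y x = 0 -> ~ O x).

Definition RM_code (R : realType) (O : set R) (a b : nat -> R) : Prop :=
  O = \bigcup_n `]a n, b n[%classic.

(* The arguments are the characteristic function of O, the R2-representation,
   E2, the component (0 for a, 1 for b) of the RM-code, the place n in that
   sequence, and the argument of the representation of its nth term. *)
Notation tyDelta := (ty2 ~~> tyRR ~~> ty2 ~~> Base ~~> Base ~~> Base ~~> Base).

Definition is_Delta (R : realType) (Delta : partial_obj tyDelta) : Prop :=
  forall (O : set R) (Y : R -> R) (o : total_obj ty2) (y : total_obj tyRR),
    O `<=` `[0, 1]%classic -> R2_representation O Y ->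
    represents_set o O -> represents_fun setT y Y ->
    exists (a b : nat -> R) (alpha beta : nat -> total_obj ty1),
      [/\ RM_code O a b,
          forall n, represents (alpha n) (a n) /\ represents (beta n) (b n)
        & forall n m, Delta o y E2 0%N n m = Some (alpha n m) /\
                      Delta o y E2 1%N n m = Some (beta n m)].

(* Functions on [0, 1] are given by functions on R of which only the values on
   [0, 1] are used. *)
Definition continuity_points (R : realType) (f : R -> R) : set R :=
  [set x : R | `[0, 1]%classic x /\
                f y @[y --> within `[0, 1]%classic (nbhs x)] --> f x].

Definition modulus_of_continuity (R : realType) (f : R -> R)
    (F : R -> nat -> nat) : Prop :=
  forall (k : nat) (x y : R), continuity_points f x -> `[0, 1]%classic y ->
    `|x - y| < 2 ^- F x k -> `|f x - f y| < 2 ^- k.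

Notation tyMBV := (tyRR ~~> ty1 ~~> Base ~~> Base).

Definition is_MBV (R : realType) (M : partial_obj tyMBV) : Prop :=
  forall (f : R -> R) (phi : total_obj tyRR),
    represents_fun `[0, 1]%classic phi f -> bounded_variation 0 1 f ->
    continuity_points f !=set0 ->
    exists F : R -> nat -> nat, modulus_of_continuity f F /\
      forall alpha x k, represents alpha x -> M phi alpha k = Some (F x k).

(* to be used only for X with at most one element *)
Definition Omega (R : realType) (X : set R) : R := xget 0 X.

Definition computes_Omega (R : realType) (e : nat)
    (Delta : partial_obj tyDelta) (M : partial_obj tyMBV) : Prop :=
  forall (X : set R) (chi : total_obj ty2),
    is_subset1 X -> represents_set chi X ->
    exists alpha : total_obj ty1, represents alpha (Omega X) /\
      forall n, kleene e [:: narg n; @targ ty2 chi; @parg tyDelta Delta;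
                             @parg tyMBV M; @targ ty2 E2] (alpha n).

(* Main.v *)
(* Let X have at most one element x.  For a rational q and a dyadic w, the
   indicator of Z = {t | q + w t in X} has bounded variation on [0,1], and a
   modulus of continuity for it, obtained from M_BV, bounds at every t outside Z
   the distance from t to Z from below.  This makes (0,1) \ Z R2-open with a
   computable representation, and Delta turns it into a union of intervals
   (a_n,b_n).  By compactness, [1/4,3/4] misses Z iff the cover of [1/4,3/4] by
   the (a_n,b_n) has a Lebesgue number, and this is arithmetical in the code, so
   that E2 decides whether x lies in the middle half of [q, q+w]; searching
   through all q approximates x up to w. *)
Require Import Defs.
From mathcomp Require Import all_boot all_order all_algebra.
From mathcomp Require Import all_classical all_reals all_analysis.
From mathcomp Require Import ring lra.

Set Implicit Arguments.
Unset Strict Implicit.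
Unset Printing Implicit Defensive.

Import Order.TTheory GRing.Theory Num.Theory.
Import numFieldNormedType.Exports.

Local Open Scope nat_scope.

Local Opaque idx.

(** * Uniform computability by S1-S9 *)

(** Two requirements shape the proof. One index must serve all inputs, so computability is stated
    for families over a parameter, and the inputs together with their hypotheses form a parameter
    type. And S8 accepts only total objects as arguments: whatever is fed to [M] or [Delta] must be
    computed at every sequence of numbers, although [M] is known to be defined only at names of
    reals. Being a name is arithmetical, so E2 can replace the other sequences beforehand. The
    modulus is consulted for points outside [Z]; membership in [Z] itself is read off from the given
    characteristic function. Its value at accuracy [2^-0] suffices, because the indicator jumps by
    1. Balls of an R2-representation are balls in the whole line, which forces 0 and 1 out of the
    open set. The test must therefore stay on a compact segment inside the open unit interval,
    whence [1/4,3/4]; windows at all rationals still catch every real by density. Emptiness of [X]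
    needs no separate test: an unsuccessful search returns 0, the code of the rational 0. *)

Definition ctx (P : Type) := seq (P -> {t : ty & arg t}).

Definition ev (P : Type) (A : ctx P) (p : P) : args := [seq x p | x <- A].

Definition pullback (P P' : Type) (h : P' -> P) (A : ctx P) : ctx P' :=
  [seq (fun p => x (h p)) | x <- A].

Definition ext (P : Type) (t : ty) (A : ctx P) : ctx (P * total_obj t) :=
  (fun p => targ p.2) :: pullback fst A.

(* The argument list and the value depend on a parameter p, the index does not.
   An abstraction over an object of finite type adds that object to the
   parameter, as in [ext]. *)
Definition computable (P : Type) (A : ctx P) (f : P -> nat) : Prop :=
  exists e, forall p, kleene e (ev A p) (f p).

Lemma ev_pullback (P P' : Type) (h : P' -> P) (A : ctx P) p :
  ev (pullback h A) p = ev A (h p).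
Proof. by rewrite /ev /pullback -map_comp. Qed.

Lemma pullback_cat (P P' : Type) (h : P' -> P) (A B : ctx P) :
  pullback h (A ++ B) = pullback h A ++ pullback h B.
Proof. exact: map_cat. Qed.

Lemma pullback_comp (P P' P'' : Type) (h : P' -> P) (h' : P'' -> P') (A : ctx P) :
  pullback h' (pullback h A) = pullback (h \o h') A.
Proof. by rewrite /pullback -map_comp. Qed.

Lemma ev_cat (P : Type) (A B : ctx P) p : ev (A ++ B) p = ev A p ++ ev B p.
Proof. exact: map_cat. Qed.

Lemma size_ev (P : Type) (A : ctx P) p : size (ev A p) = size A.
Proof. exact: size_map. Qed.

Lemma eq_computable (P : Type) (A : ctx P) (f g : P -> nat) :
  f =1 g -> computable A f -> computable A g.
Proof. by move=> fg [e H]; exists e => p; rewrite -fg. Qed.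

Lemma computable_front (P : Type) (A B : ctx P) x (f : P -> nat) :
  computable (x :: A ++ B) f -> computable (A ++ x :: B) f.
Proof.
move=> [e H]; exists (idx [:: 6; size A; e]) => p.
by rewrite ev_cat -(size_ev A p); apply: kleene_S6; rewrite -ev_cat; exact: H.
Qed.

Lemma computable_swap0 (P : Type) (B C D : ctx P) (f : P -> nat) :
  computable (B ++ C ++ D) f -> computable (C ++ B ++ D) f.
Proof.
elim/last_ind: B C => [//|B z IH] C; rewrite !cat_rcons => /(IH (z :: C)) /= H.
by rewrite catA; apply: computable_front; rewrite -catA.
Qed.

(** Only moves to the front are available: [B ++ C] is carried before [L], the two blocks are
    exchanged, and [L] is carried back. *)
Lemma computable_swap (P : Type) (L B C D : ctx P) (f : P -> nat) :
  computable (L ++ B ++ C ++ D) f -> computable (L ++ C ++ B ++ D) f.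
Proof.
move=> H; have := @computable_swap0 _ L (B ++ C) D f; rewrite -!catA.
move=> /(_ H) /computable_swap0 H1; have := @computable_swap0 _ (C ++ B) L D f.
by rewrite -!catA; apply.
Qed.

Lemma computable_const (P : Type) (A : ctx P) (q : nat) :
  computable A (fun=> q).
Proof. by exists (idx [:: 2; q]) => p; exact: kleene_S2. Qed.

Lemma computable_reparam (P P' : Type) (h : P' -> P) (A : ctx P) (f : P -> nat) :
  computable A f -> computable (pullback h A) (f \o h).
Proof. by move=> [e H]; exists e => p; rewrite ev_pullback; exact: H. Qed.

Lemma computable_let (P : Type) (A : ctx P) (g : P -> nat)
    (f : P * nat -> nat) :
  computable A g -> computable (ext Base A) f ->
  computable A (fun p => f (p, g p)).
Proof.
move=> [e H] [e' H']; exists (idx [:: 4; e'; e]) => p.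
apply: (kleene_S4 (H p)); have := H' (p, g p).
by rewrite /= ev_pullback.
Qed.

Lemma computable_call (P : Type) (A B : ctx P) (x f : P -> nat) :
  (forall p, kleene (x p) (ev A p) (f p)) ->
  computable ((fun p => narg (x p)) :: A ++ B) f.
Proof.
move=> H; exists (idx [:: 9; size A]) => p.
by rewrite /= ev_cat -(size_ev A p); apply: kleene_S9.
Qed.

Lemma computable_push (P : Type) (A : ctx P) (g f : P -> nat) :
  computable A g -> computable ((fun p => narg (g p)) :: A) f ->
  computable A f.
Proof.
move=> [e H] [e' H']; exists (idx [:: 4; e'; e]) => p.
exact: (kleene_S4 (H p) (H' p)).
Qed.

(** S9 is the scheme that drops arguments. The old index is pushed as a number, the new block [X] is
    moved to the end, and S9 runs that index on [A ++ B] alone. *)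
Lemma computable_insert (P : Type) (A B X : ctx P) (f : P -> nat) :
  computable (A ++ B) f -> computable (A ++ X ++ B) f.
Proof.
move=> [e H]; apply: (@computable_push _ _ (fun=> e)).
  exact: computable_const.
rewrite -[X ++ B]cats0 -catA.
apply: (@computable_swap _ ((fun=> narg e) :: A) B X [::]).
by rewrite cats0 /= catA; exact: computable_call.
Qed.

Lemma computable_weaken (P P' : Type) (h : P' -> P) (A B : ctx P) (X : ctx P') f :
  computable (A ++ B) f -> computable (pullback h A ++ X ++ pullback h B) (f \o h).
Proof.
move=> H; apply: computable_insert; rewrite -pullback_cat.
exact: computable_reparam.
Qed.

Lemma onth_split (P : Type) (A : ctx P) k x : onth A k = Some x ->
  A = take k A ++ x :: drop k.+1 A.
Proof.
elim: A k => [|y A IH] [|k] //=; first by move=> [->]; rewrite drop0.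
by move=> /IH {1}->.
Qed.

Lemma computable_nvar (P : Type) (A : ctx P) k (f : P -> nat) :
  onth A k = Some (fun p => narg (f p)) -> computable A f.
Proof.
move=> /onth_split ->; apply: computable_front.
by exists (idx [:: 3]) => p; exact: kleene_S3.
Qed.

Lemma computable_succ (P : Type) (A : ctx P) (f : P -> nat) :
  computable A f -> computable A (fun p => (f p).+1).
Proof.
move=> Hf; apply: (@computable_let _ _ f (fun p => p.2.+1)) => //.
by exists (idx [:: 1]) => p; exact: kleene_S1.
Qed.

Lemma computable_rec (P : Type) (A : ctx P) (f g : P -> nat)
    (h : P -> nat -> nat -> nat) :
  computable A f -> computable A g ->
  computable (ext Base (ext Base A)) (fun p => h p.1.1 p.2 p.1.2) ->
  computable A (fun p => nat_rect _ (g p) (h p) (f p)).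
Proof.
move=> Hf [eg Hg] [eh Hh].
apply: (@computable_let _ _ f (fun p => nat_rect _ (g p.1) (h p.1) p.2)) => //.
exists (idx [:: 5; eg; eh]) => -[p n]; rewrite /= ev_pullback /=.
elim: n => [|n IH] /=; first exact: kleene_S5_0.
apply: (kleene_S5_S IH); have := Hh (p, nat_rect _ (g p) (h p) n, n).
by rewrite /= ev_pullback /= ev_pullback.
Qed.

(** Each abstracted argument enters at the front of the context, so later arguments stand before
    earlier ones, as in [ktotal]. *)
Fixpoint computableT (t : ty) :
    forall (P : Type), ctx P -> (P -> total_obj t) -> Prop :=
  match t with
  | Base => fun P A g => computable A g
  | s ~~> u => fun P A g =>
      @computableT u _ (ext s A) (fun p => g p.1 p.2)
  end.

Lemma computableT_swap t (P : Type) (L B C D : ctx P) (g : P -> total_obj t) :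
  computableT (L ++ B ++ C ++ D) g -> computableT (L ++ C ++ B ++ D) g.
Proof.
elim: t P L B C D g => [|s _ u IH] P L B C D g /=.
  exact: computable_swap.
rewrite /ext !pullback_cat => H.
by have := IH _ (_ :: pullback fst L) (pullback fst B) (pullback fst C)
  (pullback fst D); apply.
Qed.

(** An abstraction puts its object in front of [A] and enlarges the parameter type. The prefix [A]
    and the map [h] make the induction on [t] go through. *)
Lemma computableT_weaken_under t (P P' : Type) (h : P' -> P) (A B : ctx P)
    (X : ctx P') (g : P -> total_obj t) :
  computableT (A ++ B) g -> computableT (pullback h A ++ X ++ pullback h B) (g \o h).
Proof.
elim: t P P' h A B X g => [|s _ u IH] P P' h A B X g /=.
  exact: computable_weaken.
rewrite /ext !pullback_cat => H; pose h' (p : P' * total_obj s) := (h p.1, p.2).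
have /(_ _ h' (pullback fst X)) := IH _ _ _ (_ :: pullback fst A) (pullback fst B) _ _ H.
by rewrite /= !pullback_comp.
Qed.

Lemma computableT_weaken t s (P : Type) (A : ctx P) (g : P -> total_obj t) :
  computableT A g -> computableT (ext s A) (fun p => g p.1).
Proof. exact: (@computableT_weaken_under t _ _ fst [::] A [:: _]). Qed.

Lemma computableT_ktotal t (P : Type) (A : ctx P) (g : P -> total_obj t) :
  computableT A g -> exists d, forall p, ktotal d (ev A p) (g p).
Proof.
elim: t P A g => [|s _ u IH] P A g /=.
  by move=> [e H]; exists e => p; exact: ktotal_Base.
move=> /IH [d H]; exists d => p; apply: ktotal_Arr => xi.
by have := H (p, xi); rewrite /= ev_pullback.
Qed.

(** S8 wants the functional at the head of the list and evaluates its arguments in that permuted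
    list, hence [h :: B ++ C]. The entry [h] is kept apart from [phi], since [phi] changes with each
    argument it receives while the list does not. *)
Definition applicable (t : ty) (P : Type) (A : ctx P) (phi : P -> partial_obj t)
    (f : P -> nat) : Prop :=
  forall (h : P -> {t : ty & arg t}) B C, A = B ++ h :: C ->
  exists ds, forall p, kapply (phi p) ds (ev (h :: B ++ C) p) (f p).

Lemma applicable_nil (P : Type) (A : ctx P) (phi : P -> option nat) f :
  (forall p, phi p = Some (f p)) -> @applicable Base _ A phi f.
Proof. by move=> H h B C _; exists [::] => p; rewrite H; exact: kapply_nil. Qed.

Lemma applicable_cons s t (P : Type) (A : ctx P)
    (phi : P -> partial_obj (s ~~> t)) (g : P -> total_obj s) f :
  computableT A g -> @applicable t _ A (fun p => phi p (g p)) f ->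
  @applicable (s ~~> t) _ A phi f.
Proof.
move=> Hg Hf h B C AE; have [ds Hds] := Hf h B C AE.
have := @computableT_swap s _ [::] B [:: h] C g; rewrite /= -AE.
by move=> /(_ Hg) /computableT_ktotal [d Hd]; exists (d :: ds) => p;
  exact: (kapply_cons (Hd p) (Hds p)).
Qed.

Lemma computable_app s t (P : Type) (A : ctx P) k
    (phi : P -> partial_obj (s ~~> t)) f :
  onth A k = Some (fun p => @parg (s ~~> t) (phi p)) ->
  @applicable (s ~~> t) _ A phi f -> computable A f.
Proof.
move=> /onth_split AE /(_ _ _ _ AE) [ds Hds]; rewrite AE; apply: computable_front.
by exists (idx (8 :: ds)) => p; exact: kleene_S8.
Qed.

(** * Arithmetic, quantifiers by E2, and search *)

Lemma computable_last (P : Type) (A : ctx P) :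
  computable (ext Base A) (fun p => p.2).
Proof. exact: (@computable_nvar _ _ 0). Qed.

Lemma computable_wk s (P : Type) (A : ctx P) (f : P -> nat) :
  computable A f -> computable (ext s A) (fun p => f p.1).
Proof. exact: (@computableT_weaken Base). Qed.

Lemma computable_wkE s (P : Type) (A : ctx P) (F : P * total_obj s -> nat) f :
  (forall p x, F (p, x) = f p) -> computable A f -> computable (ext s A) F.
Proof. by move=> E /(@computable_wk s); apply: eq_computable => -[p x]. Qed.

Ltac wk :=
  lazymatch goal with |- computable (@ext ?P ?s ?A) _ =>
    eapply (@computable_wkE s P A) end; [intros; cbn [fst snd]; reflexivity | cbn beta].

Lemma computable_add (P : Type) (A : ctx P) (f g : P -> nat) :
  computable A f -> computable A g -> computable A (fun p => f p + g p).
Proof.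
move=> Hf Hg.
apply: (@eq_computable _ _ (fun p => nat_rect _ (g p) (fun _ m => m.+1) (f p))).
  by move=> p; elim: (f p) => //= n ->.
apply: (computable_rec (h := fun _ _ m => m.+1)) => //=.
by apply: computable_succ; exact: (@computable_nvar _ _ 1).
Qed.

Lemma computable_pred (P : Type) (A : ctx P) (f : P -> nat) :
  computable A f -> computable A (fun p => (f p).-1).
Proof.
move=> Hf.
apply: (@eq_computable _ _ (fun p => nat_rect _ 0 (fun n _ => n) (f p))).
  by move=> p; case: (f p).
apply: (computable_rec (h := fun _ n _ => n)) => //=.
- exact: computable_const.
- exact: computable_last.
Qed.

Lemma computable_sub (P : Type) (A : ctx P) (f g : P -> nat) :
  computable A f -> computable A g -> computable A (fun p => f p - g p).
Proof.
move=> Hf Hg.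
apply: (@eq_computable _ _ (fun p => nat_rect _ (f p) (fun _ m => m.-1) (g p))).
  by move=> p; elim: (g p) => [|n /= ->]; rewrite ?subn0 ?subnS.
apply: (computable_rec (h := fun _ _ m => m.-1)) => //=.
by apply: computable_pred; exact: (@computable_nvar _ _ 1).
Qed.

Lemma computable_mul (P : Type) (A : ctx P) (f g : P -> nat) :
  computable A f -> computable A g -> computable A (fun p => f p * g p).
Proof.
move=> Hf Hg.
apply: (@eq_computable _ _ (fun p => nat_rect _ 0 (fun _ m => g p + m) (f p))).
  by move=> p; elim: (f p) => [|n /= ->]; rewrite ?mulSn.
apply: (computable_rec (h := fun p _ m => g p + m)) => //=.
- exact: computable_const.
- apply: computable_add; first by do 2 wk.
  exact: (@computable_nvar _ _ 1).
Qed.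

Lemma computable_exp (P : Type) (A : ctx P) (f g : P -> nat) :
  computable A f -> computable A g -> computable A (fun p => f p ^ g p).
Proof.
move=> Hf Hg.
apply: (@eq_computable _ _ (fun p => nat_rect _ 1 (fun _ m => f p * m) (g p))).
  by move=> p; elim: (g p) => [|n /= ->]; rewrite ?expnS.
apply: (computable_rec (h := fun p _ m => f p * m)) => //=.
- exact: computable_const.
- apply: computable_mul; first by do 2 wk.
  exact: (@computable_nvar _ _ 1).
Qed.

(** Truth is coded by 0, in line with the zeros that E2 detects; conjunction becomes a sum and
    disjunction a product. *)
Definition decidable_in (P : Type) (A : ctx P) (Q : P -> Prop) : Prop :=
  computable A (fun p => if `[< Q p >] then 0 else 1).

Lemma eq_decidable_in (P : Type) (A : ctx P) (Q Q' : P -> Prop) :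
  (forall p, Q p <-> Q' p) -> decidable_in A Q -> decidable_in A Q'.
Proof. by move=> QQ'; apply: eq_computable => p; rewrite (asbool_equiv_eq (QQ' p)). Qed.

Lemma decidable_in_wk s (P : Type) (A : ctx P) (Q : P -> Prop) :
  decidable_in A Q -> decidable_in (ext s A) (fun p => Q p.1).
Proof. exact: computable_wk. Qed.

Lemma decidable_in_eq0 (P : Type) (A : ctx P) (f : P -> nat) :
  computable A f -> decidable_in A (fun p => f p = 0).
Proof.
move=> Hf.
apply: (@eq_computable _ _ (fun p => nat_rect _ 0 (fun _ _ => 1) (f p))).
  move=> p; case: (f p) => [|n]/=; case: asboolP => //.
apply: (computable_rec (h := fun _ _ _ => 1)) => //=; exact: computable_const.
Qed.

Lemma decidable_in_not (P : Type) (A : ctx P) (Q : P -> Prop) :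
  decidable_in A Q -> decidable_in A (fun p => ~ Q p).
Proof.
move=> H; have := computable_sub (computable_const A 1) H.
apply: eq_computable => p; rewrite asbool_neg; by case: asboolP.
Qed.

Lemma decidable_in_and (P : Type) (A : ctx P) (Q Q' : P -> Prop) :
  decidable_in A Q -> decidable_in A Q' -> decidable_in A (fun p => Q p /\ Q' p).
Proof.
move=> H H'; have := decidable_in_eq0 (computable_add H H').
apply: eq_decidable_in => p; case: asboolP => ?; case: asboolP => ? /=;
  by split=> // -[].
Qed.

Lemma decidable_in_or (P : Type) (A : ctx P) (Q Q' : P -> Prop) :
  decidable_in A Q -> decidable_in A Q' -> decidable_in A (fun p => Q p \/ Q' p).
Proof.
move=> H H'; have := decidable_in_eq0 (computable_mul H H').
apply: eq_decidable_in => p; case: asboolP => ?; case: asboolP => ? /=;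
  by split=> //; try (by left); try (by right); case.
Qed.

Lemma decidable_in_imply (P : Type) (A : ctx P) (Q Q' : P -> Prop) :
  decidable_in A Q -> decidable_in A Q' -> decidable_in A (fun p => Q p -> Q' p).
Proof.
move=> H H'; have := decidable_in_or (decidable_in_not H) H'.
apply: eq_decidable_in => p; split; first by case.
by case: (pselect (Q p)); tauto.
Qed.

Lemma decidable_in_le (P : Type) (A : ctx P) (f g : P -> nat) :
  computable A f -> computable A g -> decidable_in A (fun p => f p <= g p).
Proof.
move=> Hf Hg; have := decidable_in_eq0 (computable_sub Hf Hg).
by apply: eq_decidable_in => p; rewrite -subn_eq0; split=> /eqP.
Qed.

Lemma decidable_in_eq (P : Type) (A : ctx P) (f g : P -> nat) :
  computable A f -> computable A g -> decidable_in A (fun p => f p = g p).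
Proof.
move=> Hf Hg.
have := decidable_in_and (decidable_in_le Hf Hg) (decidable_in_le Hg Hf).
apply: eq_decidable_in => p; split; first by move=> ?; apply/eqP; rewrite eqn_leq; apply/andP.
by move=> ->.
Qed.

Lemma computable_if (P : Type) (A : ctx P) (Q : P -> Prop) (f g : P -> nat) :
  decidable_in A Q -> computable A f -> computable A g ->
  computable A (fun p => if `[< Q p >] then f p else g p).
Proof.
move=> HQ Hf Hg; have := computable_add (computable_mul (decidable_in_not HQ) Hf)
  (computable_mul HQ Hg).
by apply: eq_computable => p; rewrite asbool_neg; case: asboolP => _ /=;
  rewrite mul0n mul1n ?addn0.
Qed.

Definition with_E2 (P : Type) (A : ctx P) : Prop :=
  exists k, onth A k = Some (fun=> @targ ty2 E2).

Lemma onth_ext (P : Type) (A : ctx P) t k x :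
  onth A k = Some x -> onth (ext t A) k.+1 = Some (fun p => x p.1).
Proof. by rewrite /= /pullback onth_map => ->. Qed.

Lemma with_E2_ext t (P : Type) (A : ctx P) : with_E2 A -> with_E2 (ext t A).
Proof. by move=> [k /(onth_ext t)]; exists k.+1. Qed.

Lemma computable_ty1 (P : Type) (A : ctx P) k (alpha : P -> total_obj ty1)
    (f : P -> nat) :
  onth A k = Some (fun p => targ (alpha p)) -> computable A f ->
  computable A (fun p => alpha p (f p)).
Proof.
move=> Hk Hf; apply: (computable_app Hk).
apply: (@applicable_cons Base Base _ _ (fun p n => Some (alpha p n)) _ _ Hf).
exact: applicable_nil.
Qed.

Lemma computable_ty2 (P : Type) (A : ctx P) k (phi : P -> total_obj ty2)
    (g : P -> total_obj ty1) :
  onth A k = Some (fun p => targ (phi p)) -> computableT A g ->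
  computable A (fun p => phi p (g p)).
Proof.
move=> Hk Hg; apply: (computable_app Hk).
apply: (@applicable_cons ty1 Base _ _ (fun p n => Some (phi p n)) _ _ Hg).
exact: applicable_nil.
Qed.

Lemma computableT_last1 (P : Type) (A : ctx P) :
  @computableT ty1 _ (ext ty1 A) (fun p => p.2).
Proof.
apply: (@computable_ty1 _ _ 1 (fun p => p.1.2)) => //.
exact: computable_last.
Qed.

(** An argument passed on by S8 must be given by an index, so E2 is presented as its own application
    to a bound sequence. *)
Lemma computableT_E2 (P : Type) (A : ctx P) :
  with_E2 A -> @computableT ty2 _ A (fun=> E2).
Proof.
move=> [k Hk].
apply: (@computable_ty2 _ _ k.+1 (fun=> E2) (fun p => p.2)); first by rewrite (onth_ext _ Hk).
exact: computableT_last1.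
Qed.

Lemma decidable_in_ex (P : Type) (A : ctx P) (Q : P -> nat -> Prop) :
  with_E2 A -> decidable_in (ext Base A) (fun p => Q p.1 p.2) ->
  decidable_in A (fun p => exists n, Q p n).
Proof.
move=> [k Hk] HQ; have := @computable_ty2 _ _ _ (fun=> E2)
  (fun p n => if `[< Q p n >] then 0 else 1) Hk HQ.
apply: eq_computable => p; rewrite /E2; congr (if _ then _ else _).
apply: asbool_equiv_eq.
by split=> -[n]; [case: asboolP => // ? _|move=> ?]; exists n => //; rewrite asboolT.
Qed.

Lemma decidable_in_all (P : Type) (A : ctx P) (Q : P -> nat -> Prop) :
  with_E2 A -> decidable_in (ext Base A) (fun p => Q p.1 p.2) ->
  decidable_in A (fun p => forall n, Q p n).
Proof.
move=> HA /decidable_in_not /(decidable_in_ex (Q := fun p n => ~ Q p n) HA).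
move=> /decidable_in_not; apply: eq_decidable_in => p; split=> [/forallNP H n|H [n]].
  exact: contrapT.
by apply.
Qed.

Definition least (Q : nat -> Prop) : nat :=
  xget 0 [set n | Q n /\ forall m, Q m -> n <= m]%classic.

Lemma leastP (Q : nat -> Prop) : (exists n, Q n) ->
  Q (least Q) /\ forall m, Q m -> least Q <= m.
Proof.
move=> [n Qn]; rewrite /least; case: xgetP => [m -> //|/(_ _) H]; exfalso.
have ex : exists n, `[< Q n >] by exists n; apply/asboolP.
case: (ex_minnP ex) => m /asboolP Qm mmin; apply: (H m); split=> // k Qk.
by apply: mmin; apply/asboolP.
Qed.

Lemma least_none (Q : nat -> Prop) : ~ (exists n, Q n) -> least Q = 0.
Proof. by move=> H; rewrite /least xgetPN // => n [Qn _]; apply: H; exists n. Qed.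

Lemma least_eq (Q Q' : nat -> Prop) : (forall n, Q n <-> Q' n) -> least Q = least Q'.
Proof. by move=> QQ'; congr least; apply/funext => n; apply/propext. Qed.

(* The searching index receives its own number x as an argument, and calls
   itself on the next candidate by S9. *)
Lemma computable_least_total (P : Type) (A : ctx P) (Q : P -> nat -> Prop) :
  (forall p, exists n, Q p n) -> decidable_in (ext Base A) (fun p => Q p.1 p.2) ->
  computable A (fun p => least (Q p)).
Proof.
move=> exQ HQ.
have [t Ht] : decidable_in (ext Base (ext Base A)) (fun p => Q p.1.1 p.1.2).
  exact: (@decidable_in_wk Base _ _ (fun p => Q p.1 p.2)).
have [g Hg] : computable (ext Base (ext Base A)) (fun p => p.1.2).
  exact: (@computable_nvar _ _ 1).
(* The recursive call need not be defined everywhere, while [computable] speaks of defined values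
   only. The parameter is therefore restricted to quadruples (p, n, x, v) for which the call of x at
   n + 1 is known to have value v. *)
pose P' := {q : P * nat * nat * nat |
  kleene q.1.2 (narg q.1.2 :: narg q.1.1.2.+1 :: ev A q.1.1.1) q.2}.
pose pP (q : P') := (sval q).1.1.1.
pose nP (q : P') := (sval q).1.1.2.
pose xP (q : P') := (sval q).1.2.
have [h Hh] : computable
    [:: (fun=> narg 0), (fun q => narg (nP q)), (fun q => narg (xP q)),
        (fun q => narg (nP q)) & pullback pP A] (fun q : P' => (sval q).2).
  apply: (@computable_push _ _ (fun q => (nP q).+1)).
    by apply: computable_succ; exact: (@computable_nvar _ _ 1).
  apply: (@computable_push _ _ xP); first exact: (@computable_nvar _ _ 3).
  apply: (@computable_push _ _ xP); first exact: (@computable_nvar _ _ 0).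
  have := @computable_swap P' [:: (fun q => narg (xP q)); (fun q => narg (xP q));
      (fun q => narg (nP q).+1)] (pullback pP A) [:: (fun=> narg 0); (fun q => narg (nP q));
      (fun q => narg (xP q)); (fun q => narg (nP q))] [::].
  rewrite /= !cats0 => swap; apply: swap.
  apply: (@computable_call P' [:: (fun q => narg (xP q)),
    (fun q => narg (nP q).+1) & pullback pP A]).
  by move=> [q Hq]; rewrite /= ev_pullback.
(* S5 acts as a case distinction on the test [t]: at 0 it returns the candidate through [g], at 1 it
   runs [h], which sees the predecessor 0 and the discarded value of [g] before the actual
   arguments. *)
pose d := idx [:: 4; idx [:: 5; g; h]; t].
have d_stop p x n : Q p n -> kleene d (narg x :: narg n :: ev A p) n.
  move=> Qpn; have := Ht (p, n, x); have := Hg (p, n, x).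
  rewrite /= !ev_pullback asboolT // => Hgn Htn.
  by apply: (kleene_S4 Htn); exact: kleene_S5_0.
have d_next p x n v : ~ Q p n -> kleene x (narg x :: narg n.+1 :: ev A p) v ->
    kleene d (narg x :: narg n :: ev A p) v.
  move=> Qpn Hx; have := Ht (p, n, x); have := Hg (p, n, x).
  rewrite /= !ev_pullback asboolF // => Hgn Htn.
  apply: (kleene_S4 Htn); apply: (kleene_S5_S (kleene_S5_0 _ Hgn)).
  by have := Hh (exist _ (p, n, x, v) Hx); rewrite /= ev_pullback.
have d_search p k n : least (Q p) = n + k ->
    kleene d (narg d :: narg n :: ev A p) (least (Q p)).
  have [Ql lmin] := leastP (exQ p).
  elim: k n => [|k IH] n lE; first by rewrite lE addn0 in Ql *; exact: d_stop.
  apply: d_next; last by apply: IH; rewrite lE addSnnS.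
  by move=> /lmin; rewrite lE addnS ltnNge leq_addr.
apply: (@computable_push _ _ (fun=> 0)); first exact: computable_const.
apply: (@computable_push _ _ (fun=> d)); first exact: computable_const.
by exists d => p; exact: d_search.
Qed.

(** E2 decides whether a witness exists. Adding the absence of witnesses as an alternative makes the
    search total; it then stops at 0, which is the default of [least]. *)
Lemma computable_least (P : Type) (A : ctx P) (Q : P -> nat -> Prop) :
  with_E2 A -> decidable_in (ext Base A) (fun p => Q p.1 p.2) ->
  computable A (fun p => least (Q p)).
Proof.
move=> HA HQ.
have HN : decidable_in A (fun p => ~ exists n, Q p n).
  by apply: decidable_in_not; exact: decidable_in_ex.
have : computable A (fun p => least (fun n => Q p n \/ ~ exists n, Q p n)).
  apply: computable_least_total => [p|].
    case: (pselect (exists n, Q p n)) => [[n Qn]|H]; first by exists n; left.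
    by exists 0; right.
  apply: decidable_in_or => //.
  exact: (@decidable_in_wk Base _ _ (fun p => ~ exists n, Q p n)).
apply: eq_computable => p.
case: (pselect (exists n, Q p n)) => exQ.
  by apply: least_eq => n; split=> [[]//|]; left.
rewrite (least_none exQ); apply/eqP; rewrite -leqn0.
by apply: (leastP _).2; [exists 0; right|right].
Qed.

Lemma computable_graph (P : Type) (A : ctx P) (f : P -> nat) :
  decidable_in (ext Base A) (fun p => f p.1 = p.2) -> computable A f.
Proof.
move=> H; have := @computable_least_total _ A (fun p n => f p = n).
move=> /(_ (fun p => ex_intro _ _ erefl) H); apply: eq_computable => p.
by have [] := leastP (ex_intro (fun n => f p = n) _ erefl).
Qed.

(** The graph is decidable: the exponent is the n for which [q ^ n] divides the number and
    [q ^ n.+1] does not. The number 0 is treated apart, since every power divides it and [logn] is 0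
    there. *)
Lemma computable_logn (P : Type) (A : ctx P) (q : nat) (f : P -> nat) :
  prime q -> with_E2 A -> computable A f -> computable A (fun p => logn q (f p)).
Proof.
move=> q_pr HA Hf; apply: computable_graph.
have HA1 := with_E2_ext Base HA; have HA2 := with_E2_ext Base HA1.
have dvdE (g : P * nat -> nat) : computable (ext Base A) g ->
    decidable_in (ext Base A) (fun p => exists m, f p.1 = m * q ^ g p).
  move=> Hg; apply: (decidable_in_ex (Q := fun p m => f p.1 = m * q ^ g p)) => //.
  apply: decidable_in_eq; first by do 2 wk.
  apply: computable_mul; first exact: computable_last.
  by apply: computable_exp; [exact: computable_const|wk].
have H1 := dvdE _ (computable_last A).
have H2 := dvdE _ (computable_succ (computable_last A)).
have H0 : decidable_in (ext Base A) (fun p => f p.1 = 0).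
  by apply: decidable_in_eq0; wk.
have H0' := decidable_in_eq0 (computable_last A).
have := decidable_in_or (decidable_in_and H0 H0') (decidable_in_and H1 (decidable_in_not H2)).
apply: eq_decidable_in => -[p n] /=; case: (posnP (f p)) => [->|fp_gt0].
  rewrite logn0; split=> [[[]//|[_ []]]|<-]; first by exists 0.
  by left.
have dvdP m : (exists k, f p = k * q ^ m) <-> m <= logn q (f p).
  by rewrite -pfactor_dvdn //; split=> /dvdnP.
rewrite !dvdP; split=> [[[f0]|[nle /negP]]|<-]; first by rewrite f0 in fp_gt0.
  by rewrite -leqNgt => ?; apply/eqP; rewrite eqn_leq; apply/andP.
by right; split=> //; rewrite ltnn.
Qed.

(** * Codes of rationals and names of reals *)

Local Open Scope classical_set_scope.
Local Open Scope ring_scope.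

Definition rat_code (i j k : nat) : nat := (2 ^ i * 3 ^ j * 5 ^ k)%N.

Lemma rat_codeK (R : realType) i j k :
  rat_of_code R (rat_code i j k) = (i%:R - j%:R) / k.+1%:R.
Proof.
have logX q r n : prime q -> prime r -> logn q (r ^ n) = (n * (q == r))%N.
  by move=> q_pr r_pr; rewrite lognX logn_prime.
by rewrite /rat_of_code /rat_code !lognM ?muln_gt0 ?expn_gt0 // !logX //=
  ?muln1 ?muln0 ?addn0 ?add0n.
Qed.

Lemma rat_of_code_ratr (R : realType) (q : rat) :
  exists c, rat_of_code R c = ratr q.
Proof.
have [k dk] : exists k : nat, denq q = k.+1%:Z.
  by case: (denq q) (denq_gt0 q) => [[//|k] _|//]; exists k.
rewrite /ratr dk; case: (numq q) => n.
  by exists (rat_code n 0 k); rewrite rat_codeK subr0.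
by exists (rat_code 0 n.+1 k); rewrite rat_codeK sub0r NegzE.
Qed.

Lemma rat_of_code0 (R : realType) : rat_of_code R 0 = 0.
Proof. by rewrite /rat_of_code !logn0 subrr mul0r. Qed.

Definition computableR (R : realType) (P : Type) (A : ctx P) (r : P -> R) : Prop :=
  exists2 f, computable A f & forall p, rat_of_code R (f p) = r p.

Lemma computableR_code (R : realType) (P : Type) (A : ctx P) (f : P -> nat) :
  computable A f -> computableR A (fun p => rat_of_code R (f p)).
Proof. by move=> Hf; exists f. Qed.

Lemma computableR_wkE s (R : realType) (P : Type) (A : ctx P)
    (F : P * total_obj s -> R) r :
  (forall p x, F (p, x) = r p) -> computableR A r -> computableR (ext s A) F.
Proof.
move=> E [f /(@computable_wk s) Hf fr]; exists (fun p => f p.1) => //.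
by move=> [p x]; rewrite E fr.
Qed.

Ltac wkR :=
  lazymatch goal with |- computableR (@ext ?P ?s ?A) _ =>
    eapply (@computableR_wkE s _ P A) end;
  [intros; cbn [fst snd]; reflexivity | cbn beta].

Lemma computable_rat_code (P : Type) (A : ctx P) (f g h : P -> nat) :
  computable A f -> computable A g -> computable A h ->
  computable A (fun p => rat_code (f p) (g p) (h p)).
Proof.
have expE q (u : P -> nat) : computable A u -> computable A (fun p => q ^ u p)%N.
  by apply: computable_exp; exact: computable_const.
by move=> Hf Hg Hh; apply: computable_mul; [apply: computable_mul|]; exact: expE.
Qed.

Lemma computableR_nat (R : realType) (P : Type) (A : ctx P) (f : P -> nat) :
  computable A f -> computableR A (fun p => (f p)%:R : R).
Proof.
move=> Hf; exists (fun p => rat_code (f p) 0 0).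
  by apply: computable_rat_code => //; exact: computable_const.
by move=> p; rewrite rat_codeK subr0 divr1.
Qed.

Definition rat_code_pow (n : nat) : nat := rat_code 1 0 (2 ^ n).-1.

Lemma rat_code_powK (R : realType) n : rat_of_code R (rat_code_pow n) = 2 ^- n.
Proof. by rewrite rat_codeK subr0 prednK ?expn_gt0 // div1r natrX. Qed.

Lemma computable_rat_code_pow (P : Type) (A : ctx P) (f : P -> nat) :
  computable A f -> computable A (fun p => rat_code_pow (f p)).
Proof.
move=> Hf; apply: computable_rat_code; [exact: computable_const|exact: computable_const|].
by apply: computable_pred; apply: computable_exp => //; exact: computable_const.
Qed.

Lemma computableR_pow (R : realType) (P : Type) (A : ctx P) (f : P -> nat) :
  computable A f -> computableR A (fun p => 2 ^- (f p) : R).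
Proof.
move=> Hf; exists (fun p => rat_code_pow (f p)); first exact: computable_rat_code_pow.
by move=> p; rewrite rat_code_powK.
Qed.

Lemma computableR_opp (R : realType) (P : Type) (A : ctx P) (r : P -> R) :
  with_E2 A -> computableR A r -> computableR A (fun p => - r p).
Proof.
move=> HA [f Hf fr].
exists (fun p => rat_code (logn 3 (f p)) (logn 2 (f p)) (logn 5 (f p))).
  by apply: computable_rat_code; exact: computable_logn.
by move=> p; rewrite rat_codeK -fr /rat_of_code -mulNr opprB.
Qed.

Definition rat_code_add (c d : nat) : nat :=
  rat_code (logn 2 c * (logn 5 d).+1 + logn 2 d * (logn 5 c).+1)
    (logn 3 c * (logn 5 d).+1 + logn 3 d * (logn 5 c).+1)
    ((logn 5 c).+1 * (logn 5 d).+1).-1.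

Definition rat_code_mul (c d : nat) : nat :=
  rat_code (logn 2 c * logn 2 d + logn 3 c * logn 3 d)
    (logn 2 c * logn 3 d + logn 3 c * logn 2 d)
    ((logn 5 c).+1 * (logn 5 d).+1).-1.

Lemma rat_code_addK (R : realType) c d :
  rat_of_code R (rat_code_add c d) = rat_of_code R c + rat_of_code R d.
Proof.
rewrite rat_codeK /rat_of_code prednK // !natrD !natrM.
have := pnatr_eq0 R (logn 5 c).+1; have := pnatr_eq0 R (logn 5 d).+1.
move: (_.+1%:R) (_.+1%:R) => a b a0 b0.
by field; rewrite a0 b0.
Qed.

Lemma rat_code_mulK (R : realType) c d :
  rat_of_code R (rat_code_mul c d) = rat_of_code R c * rat_of_code R d.
Proof.
rewrite rat_codeK /rat_of_code prednK // !natrD !natrM.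
have := pnatr_eq0 R (logn 5 c).+1; have := pnatr_eq0 R (logn 5 d).+1.
move: (_.+1%:R) (_.+1%:R) => a b a0 b0.
by field; rewrite a0 b0.
Qed.

Lemma computable_rat_code_add (P : Type) (A : ctx P) (f g : P -> nat) :
  with_E2 A -> computable A f -> computable A g ->
  computable A (fun p => rat_code_add (f p) (g p)).
Proof.
move=> HA Hf Hg.
have Hl q u : prime q -> computable A u -> computable A (fun p => logn q (u p)).
  by move=> q_pr; exact: computable_logn.
apply: computable_rat_code; [apply: computable_add|apply: computable_add|
  apply: computable_pred]; apply: computable_mul; do ?apply: computable_succ;
  exact: Hl.
Qed.

Lemma computable_rat_code_mul (P : Type) (A : ctx P) (f g : P -> nat) :
  with_E2 A -> computable A f -> computable A g ->
  computable A (fun p => rat_code_mul (f p) (g p)).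
Proof.
move=> HA Hf Hg.
have Hl q u : prime q -> computable A u -> computable A (fun p => logn q (u p)).
  by move=> q_pr; exact: computable_logn.
apply: computable_rat_code; [apply: computable_add|apply: computable_add|
  apply: computable_pred]; apply: computable_mul; do ?apply: computable_succ;
  exact: Hl.
Qed.

Lemma computableR_add (R : realType) (P : Type) (A : ctx P) (r s : P -> R) :
  with_E2 A -> computableR A r -> computableR A s ->
  computableR A (fun p => r p + s p).
Proof.
move=> HA [f Hf fr] [g Hg gs]; exists (fun p => rat_code_add (f p) (g p)).
  exact: computable_rat_code_add.
by move=> p; rewrite rat_code_addK fr gs.
Qed.

Lemma computableR_sub (R : realType) (P : Type) (A : ctx P) (r s : P -> R) :
  with_E2 A -> computableR A r -> computableR A s ->
  computableR A (fun p => r p - s p).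
Proof. by move=> HA Hr Hs; apply: computableR_add => //; exact: computableR_opp. Qed.

Lemma decidable_in_ltR (R : realType) (P : Type) (A : ctx P) (r s : P -> R) :
  with_E2 A -> computableR A r -> computableR A s ->
  decidable_in A (fun p => r p < s p).
Proof.
move=> HA Hr Hs; have [f Hf fE] := computableR_sub HA Hs Hr.
have : decidable_in A (fun p => (logn 3 (f p)).+1 <= logn 2 (f p))%N.
  by apply: decidable_in_le; try apply: computable_succ; exact: computable_logn.
apply: eq_decidable_in => p; rewrite -subr_gt0 -fE /rat_of_code.
by rewrite pmulr_lgt0 ?invr_gt0 ?ltr0n // subr_gt0 ltr_nat.
Qed.

Lemma decidable_in_leR (R : realType) (P : Type) (A : ctx P) (r s : P -> R) :
  with_E2 A -> computableR A r -> computableR A s ->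
  decidable_in A (fun p => r p <= s p).
Proof.
move=> HA Hr Hs; have := decidable_in_not (decidable_in_ltR HA Hs Hr).
by apply: eq_decidable_in => p; rewrite leNgt; split=> /negP.
Qed.

Lemma computable_at (P : Type) (A : ctx P) (alpha : P -> total_obj ty1) f :
  computableT A alpha -> computable A f -> computable A (fun p => alpha p (f p)).
Proof.
by move=> Ha Hf; apply: (@computable_let _ _ f (fun p => alpha p.1 p.2)).
Qed.

(** The first half of [represents]. By completeness it already yields a named real, and it is
    arithmetical, so E2 recognises names. *)
Definition fast_cauchy (R : realType) (alpha : total_obj ty1) : Prop :=
  forall n i : nat,
    `|rat_of_code R (alpha n) - rat_of_code R (alpha (n + i)%N)| < 2 ^- n.

Lemma decidable_in_fast_cauchy (R : realType) (P : Type) (A : ctx P)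
    (alpha : P -> total_obj ty1) :
  with_E2 A -> computableT A alpha ->
  decidable_in A (fun p => fast_cauchy R (alpha p)).
Proof.
move=> HA Ha; have HA1 := with_E2_ext Base HA; have HA2 := with_E2_ext Base HA1.
have Ha2 := computableT_weaken Base (computableT_weaken Base Ha).
pose q n p := rat_of_code R (alpha p n).
apply: (decidable_in_all (Q := fun p n => forall i, `|q n p - q (n + i)%N p| < 2 ^- n)) => //.
apply: (decidable_in_all
  (Q := fun p i => `|q p.2 p.1 - q (p.2 + i)%N p.1| < 2 ^- p.2)) => //.
have H1 : computable (ext Base (ext Base A)) (fun p => p.1.2).
  exact: (@computable_nvar _ _ 1).
have H2 := computable_last (ext Base A).
have Hq u : computable (ext Base (ext Base A)) u ->
    computableR (ext Base (ext Base A)) (fun p => q (u p) p.1.1).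
  by move=> Hu; apply/computableR_code/(computable_at Ha2).
have Hd := computableR_sub HA2 (Hq _ H1) (Hq _ (computable_add H1 H2)).
have Hp := computableR_pow R H1.
have := decidable_in_and (decidable_in_ltR HA2 Hd Hp)
  (decidable_in_ltR HA2 (computableR_opp HA2 Hp) Hd).
apply: eq_decidable_in => p; rewrite ltr_norml.
by split=> [[-> ->]//|/andP[]].
Qed.

Lemma pow2N_gt0 (R : realType) n : 0 < 2 ^- n :> R.
Proof. by rewrite invr_gt0 exprn_gt0. Qed.

Lemma pow2N_small (R : realType) (e : R) : 0 < e -> exists n, 2 ^- n < e.
Proof.
move=> e0; have [n _ /(_ n (leqnn n)) H] := near_infty_natSinv_expn_lt (PosNum e0).
by exists n; rewrite -div1r.
Qed.

Lemma pow2N_le (R : realType) m n : (m <= n)%N -> 2 ^- n <= 2 ^- m :> R.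
Proof.
move=> mn; rewrite lef_pV2 ?posrE ?exprn_gt0 //.
by apply: ler_weXn2l => //; rewrite ler1n.
Qed.

Lemma rat_of_code_dense (R : realType) (x y : R) :
  x < y -> exists c, x < rat_of_code R c < y.
Proof.
move=> /rat_in_itvoo[q]; rewrite inE /= => /itvP h.
by have [c cq] := rat_of_code_ratr R q; exists c; rewrite cq !h.
Qed.

Lemma represents_dist (R : realType) alpha (x : R) n :
  represents alpha x -> `|rat_of_code R (alpha n) - x| <= 2 ^- n.
Proof.
move=> [ca cvg_a].
have cv : (rat_of_code R (alpha n) - rat_of_code R (alpha m)) @[m --> \oo] -->
    (rat_of_code R (alpha n) - x).
  by apply: cvgB => //; exact: cvg_cst.
apply: (cvgr_to_le (cvg_norm cv)); exists n => // m /= nm.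
by rewrite -(subnKC nm); apply: ltW; exact: ca.
Qed.

(** The extra bit pays for the triangle inequality: two errors below [2 ^- n.+1] add up to less than
    [2 ^- n]. *)
Lemma represents_intro (R : realType) alpha (x : R) :
  (forall n, `|rat_of_code R (alpha n) - x| < 2 ^- n.+1) -> represents alpha x.
Proof.
move=> H; split=> [n i|].
  have := H n; have := H (n + i)%N; have := @pow2N_le R n.+1 (n + i).+1 (leq_addr _ _).
  have E : 2 ^- n = 2 ^- n.+1 + 2 ^- n.+1 :> R.
    by rewrite exprS invfM; set a := 2 ^- n; lra.
  rewrite E !ltr_norml; set a := 2 ^- n.+1; set b := 2 ^- (n + i).+1; lra.
apply/cvgrPdist_lt => e e0; have [n en] := pow2N_small e0.
exists n => // m /= nm; rewrite distrC (lt_trans _ en) // (lt_le_trans (H m)) //.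
by apply: pow2N_le; exact: leqW.
Qed.

Lemma represents_cst (R : realType) c : represents (fun=> c) (rat_of_code R c).
Proof. by apply: represents_intro => n; rewrite subrr normr0 pow2N_gt0. Qed.

(** Turns a strict comparison into a number quantifier over the name. A precision below half the gap
    works, because both the approximation error and the margin cost [2 ^- n]. *)
Lemma represents_gt (R : realType) alpha (x r : R) : represents alpha x ->
  (exists n, r < rat_of_code R (alpha n) - 2 ^- n) <-> r < x.
Proof.
move=> ax; split=> [[n]|rx].
  by have := represents_dist n ax; rewrite ler_norml; set a := 2 ^- n; lra.
have [n] : exists n, 2 ^- n < (x - r) / 2 by apply: pow2N_small; lra.
have := represents_dist n ax; rewrite ler_norml; set a := 2 ^- n => ? ?.
by exists n; rewrite -/a; lra.
Qed.

Lemma represents_lt (R : realType) alpha (x r : R) : represents alpha x ->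
  (exists n, rat_of_code R (alpha n) + 2 ^- n < r) <-> x < r.
Proof.
move=> ax; split=> [[n]|rx].
  by have := represents_dist n ax; rewrite ler_norml; set a := 2 ^- n; lra.
have [n] : exists n, 2 ^- n < (r - x) / 2 by apply: pow2N_small; lra.
have := represents_dist n ax; rewrite ler_norml; set a := 2 ^- n => ? ?.
by exists n; rewrite -/a; lra.
Qed.

Lemma fast_cauchy_represents (R : realType) alpha :
  fast_cauchy R alpha -> exists x : R, represents alpha x.
Proof.
move=> ca; suff : cvgn (fun n => rat_of_code R (alpha n)).
  by move=> cv; exists (lim (rat_of_code R (alpha n) @[n --> \oo])); split.
apply/cauchy_cvgP/cauchy_exP => e e0; have [n en] := pow2N_small e0.
exists (rat_of_code R (alpha n)); exists n => // m /= nm.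
by rewrite /ball /= -(subnKC nm) (lt_trans _ en).
Qed.

Lemma decidable_in_gt (R : realType) (P : Type) (A : ctx P)
    (alpha : P -> total_obj ty1) (r : P -> R) :
  with_E2 A -> computableT A alpha -> computableR A r ->
  decidable_in A (fun p => exists n, r p < rat_of_code R (alpha p n) - 2 ^- n).
Proof.
move=> HA Ha Hr; have HA1 := with_E2_ext Base HA.
apply: (decidable_in_ex (Q := fun p n => r p < rat_of_code R (alpha p n) - 2 ^- n)) => //.
apply: decidable_in_ltR => //; first by wkR.
apply: computableR_sub => //; last exact/computableR_pow/computable_last.
by apply: computableR_code.
Qed.

Lemma decidable_in_lt (R : realType) (P : Type) (A : ctx P)
    (alpha : P -> total_obj ty1) (r : P -> R) :
  with_E2 A -> computableT A alpha -> computableR A r ->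
  decidable_in A (fun p => exists n, rat_of_code R (alpha p n) + 2 ^- n < r p).
Proof.
move=> HA Ha Hr; have HA1 := with_E2_ext Base HA.
apply: (decidable_in_ex (Q := fun p n => rat_of_code R (alpha p n) + 2 ^- n < r p)) => //.
apply: decidable_in_ltR => //; last by wkR.
apply: computableR_add => //; last exact/computableR_pow/computable_last.
by apply: computableR_code.
Qed.

(** * Sets with at most one element *)

(** Jordan decomposition: the indicator of a point is the difference of two nondecreasing step
    functions that differ only at that point. *)
Lemma indic_bounded_variation (R : realType) (Z : set R) :
  is_subset1 Z -> bounded_variation 0 1 (\1_Z : R -> R).
Proof.
move=> Z1; have [[x Zx]|Z0] := pselect (exists x, Z x); last first.
  apply: nondecreasing_bounded_variation => y z _ _ _.
  by rewrite !indicE !memNset // => ?; apply: Z0; [exists z|exists y].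
have -> : (\1_Z : R -> R) = (fun y => (x <= y)%R%:R) \+ \- (fun y => (x < y)%R%:R).
  apply/funext => y; rewrite /= indicE; case: ltgtP => xy.
  - by rewrite subrr memNset // => /(Z1 _ _ Zx) E; rewrite E ltxx in xy.
  - by rewrite subrr memNset // => /(Z1 _ _ Zx) E; rewrite E ltxx in xy.
  - by rewrite subr0 mem_set // -xy.
apply: bounded_variationD; rewrite ?ltr01 //; last apply: bounded_variationN.
all: apply: nondecreasing_bounded_variation => y z _ _ yz; rewrite ler_nat.
  by case xy: (x <= y); rewrite // (le_trans xy yz).
by case xy: (x < y); rewrite // (lt_le_trans xy yz).
Qed.

(** Off [Z] the indicator vanishes on the ball whose radius is the distance to the only possible
    element. *)
Lemma indic_continuity_point (R : realType) (Z : set R) t :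
  is_subset1 Z -> `[0, 1]%classic t -> ~ Z t -> continuity_points (\1_Z : R -> R) t.
Proof.
move=> Z1 t01 Zt; split=> //.
have -> : \1_Z t = 0 :> R by rewrite indicE memNset.
apply: cvg_within_filter; apply: cvg_near_cst.
have [[x Zx]|Z0] := pselect (exists x, Z x); last first.
  by apply: nearW => y; rewrite indicE memNset // => Zy; apply: Z0; exists y.
have tx : 0 < `|t - x|.
  by rewrite normr_gt0 subr_eq0; apply: contra_notN Zt => /eqP ->.
apply: (@filterS _ (nbhs t) _ (ball t `|t - x|)); last exact: nbhsx_ballx.
move=> y; rewrite /ball /= => ty.
by rewrite indicE memNset // => Zy; rewrite (Z1 _ _ Zy Zx) ltxx in ty.
Qed.

(** 0 and 1 cannot both belong to [Z]. *)
Lemma indic_continuity_points_nonempty (R : realType) (Z : set R) :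
  is_subset1 Z -> continuity_points (\1_Z : R -> R) !=set0.
Proof.
move=> Z1; have [Z0|Z0] := pselect (Z 0).
  exists 1; apply: indic_continuity_point => //; first by rewrite /= in_itv /= ler01 lexx.
  by move=> /(Z1 _ _ Z0) /esym/eqP; rewrite oner_eq0.
by exists 0; apply: indic_continuity_point => //; rewrite /= in_itv /= ler01 lexx.
Qed.

(** A point of [Z] within the modulus would make the indicator jump by 1, whereas accuracy [2 ^- 0]
    demands a change strictly below 1. *)
Lemma indic_modulus (R : realType) (Z : set R) (F : R -> nat -> nat) t y :
  is_subset1 Z -> modulus_of_continuity (\1_Z : R -> R) F ->
  `[0, 1]%classic t -> `[0, 1]%classic y -> ~ Z t -> `|t - y| < 2 ^- F t 0%N -> ~ Z y.
Proof.
move=> Z1 HF t01 y01 Zt ty Zy.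
have := HF 0%N t y (indic_continuity_point Z1 t01 Zt) y01 ty.
by rewrite !indicE memNset // mem_set // sub0r normrN normr1 expr0 invr1 ltxx.
Qed.

Definition punctured (R : realType) (Z : set R) : set R :=
  [set t | [/\ 0 < t, t < 1 & ~ Z t]].

(** Any such m gives a ball that avoids [Z] and stays inside the unit interval. Taking the least one
    makes the radius a function of the real rather than of its name. *)
Definition radius_exponent (R : realType) (F : R -> nat) (t : R) : nat :=
  least (fun m => [/\ (F t <= m)%N, 2 ^- m < t & t < 1 - 2 ^- m]).

Definition safe_radius (R : realType) (Z : set R) (F : R -> nat) (t : R) : R :=
  if `[< punctured Z t >] then 2 ^- (radius_exponent F t) else 0.

Lemma safe_radius_R2_representation (R : realType) (Z : set R) (F : R -> nat -> nat) :
  is_subset1 Z -> modulus_of_continuity (\1_Z : R -> R) F ->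
  R2_representation (punctured Z) (safe_radius Z (F^~ 0%N)).
Proof.
move=> Z1 HF t; rewrite /safe_radius; case: asboolP => Ot; last by split.
split=> [_|/eqP]; last by rewrite gt_eqF ?pow2N_gt0.
split; first exact: pow2N_gt0.
have [t0 t1 Zt] := Ot; set G := radius_exponent _ _.
have exG : exists m, [/\ (F t 0 <= m)%N, 2 ^- m < t & t < 1 - 2 ^- m].
  have [n n0] : exists n, 2 ^- n < Num.min t (1 - t).
    by apply: pow2N_small; rewrite lt_min t0 subr_gt0.
  have := @pow2N_le R n (maxn (F t 0%N) n) (leq_maxr _ _).
  move: n0; rewrite lt_min => /andP[nt n1] nn.
  exists (maxn (F t 0%N) n); split; first exact: leq_maxl.
    exact: le_lt_trans nt.
  by move: nn n1; set a := 2 ^- n; set b := 2 ^- _; lra.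
have [FG Gt G1] : [/\ (F t 0 <= G)%N, 2 ^- G < t & t < 1 - 2 ^- G] :=
  (leastP exG).1.
move=> y; rewrite /ball /= => ty.
have {Gt G1} [y0 y1] : 0 < y /\ y < 1.
  by move: ty Gt G1; rewrite ltr_norml; set a := 2 ^- G; move=> /andP[] *; lra.
split=> //; apply: (indic_modulus Z1 HF _ _ Zt); rewrite /= ?in_itv /= ?ltW //.
by apply: lt_le_trans ty _; exact: pow2N_le.
Qed.

(* The right-hand side only mentions the reals a n and b n through comparisons
   with rationals; 2^-k is a Lebesgue number of the cover of [p, q]. *)
Lemma RM_code_covers (R : realType) (O : set R) (a b : nat -> R) (p q : R) :
  p < q -> RM_code O a b ->
  `[p, q]%classic `<=` O <-> exists k, forall c,
    p <= rat_of_code R c <= q -> exists n,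
      a n < rat_of_code R c - 2 ^- k /\ rat_of_code R c + 2 ^- k < b n.
Proof.
move=> pq OE; split=> [KO|[k Hk] t].
  pose P k x := exists n, a n < x - 2 ^- k /\ x + 2 ^- k < b n.
  (* Near-covering form of compactness: if around each point one interval works with every large
     exponent, then some exponent works on the whole segment. *)
  have := (compact_near_coveringP _).1 (@segment_compact R p q) nat \oo P _.
  case=> [x /KO|N _ /(_ N (leqnn N)) H]; last first.
    by exists N => c Hc; apply: H; rewrite /= in_itv.
  rewrite OE => -[n _]; rewrite /= in_itv /= => /andP[ax xb].
  (* Half the distance to the ends is used for moving from x to y, the other half for the margin
     [2 ^- m]. *)
  have [k] : exists k, 2 ^- k < Num.min (x - a n) (b n - x) / 2.
    by apply: pow2N_small; rewrite divr_gt0 // lt_min !subr_gt0 ax.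
  rewrite ltr_pdivlMr // lt_min => /andP[ka kb].
  near=> y m.
  have ym : ball x (2 ^- k) y.
    by near: y; exact/nbhsx_ballx/pow2N_gt0.
  have km : (k <= m)%N by near: m; exact: nbhs_infty_ge.
  exists n; move: ym ka kb (pow2N_le R km); rewrite /ball /= ltr_norml.
  set e := 2 ^- k; set d := 2 ^- m; move=> /andP[] *; split; lra.
rewrite /= in_itv /= => /andP[pt tq].
have k0 := pow2N_gt0 R k.
have [c /andP[tc cq] cp] : exists2 c, t - 2 ^- k < rat_of_code R c < t + 2 ^- k &
    p <= rat_of_code R c <= q.
  (* The nearby rational must stay in the segment, so it is taken to the right of t, or to its left
     when t is the right end. *)
  have [tq'|qt] := ltP t q.
    have [|c] := @rat_of_code_dense R t (Num.min q (t + 2 ^- k)).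
      by rewrite lt_min tq' ltrDl.
    rewrite lt_min => /and3P[tc cq ct]; exists c; first by rewrite ct; apply/andP; lra.
    by apply/andP; lra.
  have [|c] := @rat_of_code_dense R (Num.max p (t - 2 ^- k)) t.
    by rewrite gt_max ltrBlDr ltrDl k0 (lt_le_trans pq).
  rewrite gt_max => /andP[/andP[tc cq] ct]; exists c; last by apply/andP; lra.
  by rewrite cq; lra.
have [n [an bn]] := Hk c cp; rewrite OE; exists n => //; rewrite /= in_itv /=.
by apply/andP; split; lra.
Unshelve. all: by end_near.
Qed.

(** * The functional Omega *)

(** Bundling the hypotheses restricts the parameter to legitimate inputs, so [computable] over this
    type asserts one index for all of them. *)
Record input (R : realType) := Input {
  in_Delta : partial_obj tyDelta;
  in_M : partial_obj tyMBV;
  in_X : set R;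
  in_chi : total_obj ty2;
  in_DeltaP : is_Delta R in_Delta;
  in_MP : is_MBV R in_M;
  in_X1 : is_subset1 in_X;
  in_chiP : represents_set in_chi in_X }.

Definition input_ctx (R : realType) : ctx (input R) :=
  [:: (fun p => @targ ty2 (in_chi p)); (fun p => @parg tyDelta (in_Delta p));
      (fun p => @parg tyMBV (in_M p)); (fun=> @targ ty2 E2)].

(* (p, l, c) stands for the input p and the window of length 2^-(l+2) to the
   right of the rational with code c. *)
Definition window (R : realType) : Type :=
  (input R * total_obj Base * total_obj Base)%type.

Definition window_ctx (R : realType) : ctx (window R) :=
  ext Base (ext Base (input_ctx R)).

Definition slice (R : realType) (p : window R) : set R :=
  [set t | in_X p.1.1 (rat_of_code R p.2 + 2 ^- p.1.2.+2 * t)].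

Definition rescale (l c : nat) (alpha : total_obj ty1) : total_obj ty1 :=
  fun n => rat_code_add c (rat_code_mul (rat_code_pow l.+2) (alpha n)).

Definition slice_indic (R : realType) (p : window R) : total_obj tyRR :=
  fun alpha _ => rat_code (in_chi p.1.1 (rescale p.1.2 p.2 alpha)) 0 0.

(* Needed because M may be undefined on names of no real. *)
Definition normalize (R : realType) (alpha : total_obj ty1) : total_obj ty1 :=
  fun n => if `[< fast_cauchy R alpha >] then alpha n else 0%N.

(** The default is never taken: [slice_modulusP] shows that [M] is defined at every normalized
    sequence. *)
Definition slice_modulus (R : realType) (p : window R) (alpha : total_obj ty1) :
    nat :=
  odflt 0%N (in_M p.1.1 (slice_indic p) (normalize R alpha) 0%N).

Definition in_punctured (R : realType) (p : window R) (alpha : total_obj ty1) :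
    Prop :=
  [/\ exists n, 0 < rat_of_code R (alpha n) - 2 ^- n,
      exists n, rat_of_code R (alpha n) + 2 ^- n < 1 &
      in_chi p.1.1 (rescale p.1.2 p.2 alpha) = 0%N].

Definition punctured_char (R : realType) (p : window R) : total_obj ty2 :=
  fun alpha => if `[< in_punctured p alpha >] then 1%N else 0%N.

Definition name_radius_exponent (R : realType) (p : window R)
    (alpha : total_obj ty1) : nat :=
  least (fun m => [/\ (slice_modulus p alpha <= m)%N,
    exists n, 2 ^- m < rat_of_code R (alpha n) - 2 ^- n &
    exists n, rat_of_code R (alpha n) + 2 ^- n < 1 - 2 ^- m]).

Definition punctured_radius (R : realType) (p : window R) : total_obj tyRR :=
  fun alpha _ => if `[< in_punctured p alpha >]
    then rat_code_pow (name_radius_exponent p alpha) else 0%N.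

Definition punctured_code (R : realType) (p : window R) (i n : nat) :
    total_obj ty1 :=
  fun m => odflt 0%N
    (in_Delta p.1.1 (punctured_char p) (punctured_radius p) E2 i n m).

(** Negation of the criterion in [RM_code_covers] for [1/4,3/4], with the comparisons of the
    interval ends expressed through their names. Only number quantifiers remain. *)
Definition slice_hit (R : realType) (p : window R) : Prop :=
  ~ exists k, forall c,
    2 ^- 2 <= rat_of_code R c <= 1 - 2 ^- 2 -> exists n,
      (exists m, rat_of_code R (punctured_code p 0 n m) + 2 ^- m <
        rat_of_code R c - 2 ^- k) /\
      (exists m, rat_of_code R c + 2 ^- k <
        rat_of_code R (punctured_code p 1 n m) - 2 ^- m).

(** The code found serves directly as the rational approximation. If no window is hit, the default 0
    codes the rational 0, the value of [Omega] at the empty set. *)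
Definition omega_name (R : realType) (p : input R) : total_obj ty1 :=
  fun l => least (fun c => slice_hit (p, l, c)).

(** * Correctness of the construction on names *)

(** The window length is at most 1/4 for every l, so scaling reduces the error to [2 ^- n.+2] and
    the name can be read at the same place n. *)
Lemma rescaleP (R : realType) l c alpha (x : R) : represents alpha x ->
  represents (rescale l c alpha) (rat_of_code R c + 2 ^- l.+2 * x).
Proof.
move=> ax; apply: represents_intro => n.
rewrite rat_code_addK rat_code_mulK rat_code_powK opprD addrACA subrr add0r.
rewrite -mulrBr normrM ger0_norm ?(ltW (pow2N_gt0 _ _)) //.
apply: (@le_lt_trans _ _ (2 ^- 2 * 2 ^- n)).
  by apply: ler_pM => //; [exact: pow2N_le|exact: represents_dist].
by have := pow2N_gt0 R n; rewrite !exprS !invfM expr0 invr1; set a := 2 ^- n; lra.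
Qed.

Lemma slice_subset1 (R : realType) (p : window R) : is_subset1 (slice p).
Proof.
move=> t u Xt Xu; have /addrI := in_X1 Xt Xu.
by apply: mulfI; rewrite gt_eqF ?pow2N_gt0.
Qed.

Lemma slice_chi (R : realType) (p : window R) alpha t : represents alpha t ->
  (slice p t -> in_chi p.1.1 (rescale p.1.2 p.2 alpha) = 1%N) /\
  (~ slice p t -> in_chi p.1.1 (rescale p.1.2 p.2 alpha) = 0%N).
Proof. by move=> /(rescaleP p.1.2 p.2); exact: in_chiP. Qed.

Lemma slice_indicP (R : realType) (p : window R) :
  represents_fun `[0, 1]%classic (slice_indic p) (\1_(slice p) : R -> R).
Proof.
move=> alpha t at_ _; have [H1 H0] := slice_chi p at_.
suff -> : \1_(slice p) t = rat_of_code R (slice_indic p alpha 0%N).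
  exact: represents_cst.
rewrite rat_codeK subr0 divr1 indicE; have [Zt|Zt] := pselect (slice p t).
  by rewrite H1 // mem_set.
by rewrite H0 // memNset.
Qed.

Lemma normalize_id (R : realType) alpha (x : R) :
  represents alpha x -> normalize R alpha = alpha.
Proof. by move=> [ca _]; apply/funext => n; rewrite /normalize asboolT. Qed.

Lemma normalize_represents (R : realType) alpha :
  exists x : R, represents (normalize R alpha) x.
Proof.
have [ca|nca] := pselect (fast_cauchy R alpha).
  have [x ax] := fast_cauchy_represents ca.
  by exists x; rewrite (normalize_id ax).
exists (rat_of_code R 0); have -> : normalize R alpha = fun=> 0%N.
  by apply/funext => n; rewrite /normalize asboolF.
exact: represents_cst.
Qed.

(** The second clause is the definedness that S8 requires at all sequences; the third makes the
    value independent of the name. *)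
Lemma slice_modulusP (R : realType) (p : window R) :
  exists F : R -> nat -> nat,
  [/\ modulus_of_continuity (\1_(slice p) : R -> R) F,
    forall alpha, in_M p.1.1 (slice_indic p) (normalize R alpha) 0%N =
      Some (slice_modulus p alpha) &
    forall alpha x, represents alpha x -> slice_modulus p alpha = F x 0%N].
Proof.
have Z1 := @slice_subset1 R p.
have [F [HF MF]] := in_MP p.1.1 (@slice_indicP R p) (indic_bounded_variation Z1)
  (indic_continuity_points_nonempty Z1).
exists F; split=> // [alpha|alpha x ax]; rewrite /slice_modulus.
  by have [x ax] := normalize_represents R alpha; rewrite (MF _ _ _ ax).
by rewrite (normalize_id ax) (MF _ _ _ ax).
Qed.

Lemma in_puncturedP (R : realType) (p : window R) alpha t :
  represents alpha t -> in_punctured p alpha <-> punctured (slice p) t.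
Proof.
move=> at_; have [H1 H0] := slice_chi p at_.
rewrite /in_punctured (propext (represents_gt _ at_)) (propext (represents_lt _ at_)).
split=> -[t0 t1 Zt]; split=> //; last exact: H0.
by move=> /H1; rewrite Zt.
Qed.

Lemma punctured_charP (R : realType) (p : window R) :
  represents_set (punctured_char p) (punctured (slice p)).
Proof.
move=> alpha t /(in_puncturedP p) H; rewrite /punctured_char.
by case: asboolP => Oa; split=> // Ot; exfalso; [apply/Ot/H|apply/Oa/H].
Qed.

(** The radius is 0 or a power of 2, so a constant sequence names it; the search behind it sees the
    name only through comparisons that depend on the real alone. *)
Lemma punctured_radiusP (R : realType) (p : window R) F :
  (forall alpha x, represents alpha x -> slice_modulus p alpha = F x) ->
  represents_fun setT (punctured_radius p) (safe_radius (slice p) F).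
Proof.
move=> HF alpha t at_ _.
suff -> : safe_radius (slice p) F t = rat_of_code R (punctured_radius p alpha 0%N).
  exact: represents_cst.
rewrite /safe_radius /punctured_radius (asbool_equiv_eq (in_puncturedP p at_)).
case: ifP => _; last by rewrite rat_of_code0.
rewrite rat_code_powK; congr (2 ^- _); apply: least_eq => m.
by rewrite (HF _ _ at_) (propext (represents_gt _ at_)) (propext (represents_lt _ at_)).
Qed.

(** The last clause shows that the default in [punctured_code] is not taken for either component, as
    needed for applying S8 to [Delta]. *)
Lemma punctured_codeP (R : realType) (p : window R) :
  exists a b : nat -> R,
  [/\ RM_code (punctured (slice p)) a b,
    forall n, represents (punctured_code p 0 n) (a n) /\
      represents (punctured_code p 1 n) (b n) &
    forall i n m, (i <= 1)%N ->
      in_Delta p.1.1 (punctured_char p) (punctured_radius p) E2 i n m =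
      Some (punctured_code p i n m)].
Proof.
have [F [HF _ FE]] := slice_modulusP p.
have sub01 : punctured (slice p) `<=` `[0, 1]%classic.
  by move=> t [t0 t1 _]; rewrite /= in_itv /= !ltW.
have [a [b [alpha [beta [Oab ab DE]]]]] := in_DeltaP p.1.1 sub01
  (safe_radius_R2_representation (@slice_subset1 R p) HF) (@punctured_charP R p)
  (punctured_radiusP (F := F^~ 0%N) FE).
have E0 n : punctured_code p 0 n = alpha n.
  by apply/funext => m; rewrite /punctured_code (DE n m).1.
have E1 n : punctured_code p 1 n = beta n.
  by apply/funext => m; rewrite /punctured_code (DE n m).2.
exists a, b; split=> // [n|[|[|//]] n m _]; first by rewrite E0 E1.
  by rewrite E0 (DE n m).1.
by rewrite E1 (DE n m).2.
Qed.

Lemma slice_hitP (R : realType) (p : window R) :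
  slice_hit p <-> exists2 t, 2 ^- 2 <= t <= 1 - 2 ^- 2 & slice p t.
Proof.
have [a [b [Oab ab _]]] := punctured_codeP p.
have q0 := pow2N_gt0 R 2.
have q1 : 2 ^- 2 < 1 - 2 ^- 2 :> R.
  by rewrite !exprS !invfM expr0 invr1; lra.
have covers := RM_code_covers q1 Oab.
have codes k c n :
    (exists m, rat_of_code R (punctured_code p 0 n m) + 2 ^- m <
      rat_of_code R c - 2 ^- k) /\
    (exists m, rat_of_code R c + 2 ^- k <
      rat_of_code R (punctured_code p 1 n m) - 2 ^- m) <->
    a n < rat_of_code R c - 2 ^- k /\ rat_of_code R c + 2 ^- k < b n.
  by have [an bn] := ab n; rewrite (represents_lt _ an) (represents_gt _ bn).
split=> [nC|[t t01 Zt] [k Hk]].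
  apply: contrapT => nZ; apply: nC.
  have /covers [k Hk] : `[(2 ^- 2 : R), 1 - 2 ^- 2]%classic `<=` punctured (slice p).
    move=> t /=; rewrite in_itv /= => t01; split; last by move=> Zt; apply: nZ; exists t.
      by case/andP: t01 => t0 _; exact: lt_le_trans t0.
    by case/andP: t01 => _ t1; apply: le_lt_trans t1 _; rewrite ltrBlDr ltrDl.
  by exists k => c /Hk[n]; rewrite -codes; exists n.
have /covers /(_ t) : exists k, forall c, 2 ^- 2 <= rat_of_code R c <= 1 - 2 ^- 2 ->
    exists n, a n < rat_of_code R c - 2 ^- k /\ rat_of_code R c + 2 ^- k < b n.
  by exists k => c /Hk[n]; rewrite codes; exists n.
by rewrite /= in_itv /= => /(_ t01) [].
Qed.

Lemma omega_nameP (R : realType) (p : input R) :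
  represents (omega_name p) (Omega (in_X p)).
Proof.
have [[x Xx]|X0] := pselect (exists x, in_X p x); last first.
  rewrite /Omega xgetPN => [|x Xx]; last by apply: X0; exists x.
  have -> : omega_name p = fun=> 0%N.
    apply/funext => l; apply: least_none => -[c] /slice_hitP[t _ Xt].
    by apply: X0; exists (rat_of_code R c + 2 ^- l.+2 * t).
  by rewrite -(rat_of_code0 R); exact: represents_cst.
rewrite /Omega (xget_subset1 _ Xx (@in_X1 _ p)); apply: represents_intro => l.
have [w w0 wE] : exists2 w : R, 0 < w & 2 ^- l.+2 = w.
  by exists (2 ^- l.+2) => //; exact: pow2N_gt0.
have q4 : 2 ^- 2 = 1 / 4 :> R.
  by rewrite !exprS !invfM expr0 invr1; lra.
have exc : exists c, slice_hit (p, l, c).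
  (* These bounds place (x - c) / w strictly between 1/4 and 3/4. *)
  have [|c /andP[c1 c2]] := @rat_of_code_dense R (x - w * (3 / 4)) (x - w * (1 / 4)).
    by lra.
  exists c; apply/slice_hitP; exists ((x - rat_of_code R c) / w).
    by rewrite q4 ler_pdivlMr // ler_pdivrMr //; apply/andP; split; lra.
  by rewrite /slice /= wE mulrC divfK ?gt_eqF // addrC subrK.
have [/slice_hitP[t t01 Xt] _] := leastP exc.
rewrite /omega_name; move: (least _) Xt => c; rewrite /slice /= wE => Xt.
rewrite (in_X1 Xx Xt) opprD addrA subrr sub0r normrN normrM.
rewrite !gtr0_norm //; last by rewrite (lt_le_trans _ (andP t01).1) ?pow2N_gt0.
have -> : 2 ^- l.+1 = 2 * w.
  by rewrite -wE [2 ^+ l.+2]exprS invfM mulVKf ?pnatr_eq0.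
(* The error is [t * w] with t at most 3/4, well below the allowed [2 * w]. *)
move: t01; rewrite q4 => /andP[t1 t2]; rewrite mulrC ltr_pM2r //; lra.
Qed.

(** * Computability of the construction *)

Lemma computable_rescale (P : Type) (A : ctx P) (l c : P -> nat)
    (alpha : P -> total_obj ty1) :
  with_E2 A -> computable A l -> computable A c -> computableT A alpha ->
  @computableT ty1 _ A (fun p => rescale (l p) (c p) (alpha p)).
Proof.
move=> HA Hl Hc Ha; have HA1 := with_E2_ext Base HA.
apply: computable_rat_code_add => //; first by wk.
apply: computable_rat_code_mul => //.
by apply: computable_rat_code_pow; do 2 apply: computable_succ; wk.
Qed.

Lemma with_E2_window (R : realType) : with_E2 (window_ctx R).
Proof. by exists 5. Qed.

Lemma computable_slice_chi (R : realType) :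
  computable (ext ty1 (window_ctx R))
    (fun q => in_chi q.1.1.1 (rescale q.1.1.2 q.1.2 q.2)).
Proof.
apply: (@computable_ty2 _ _ 3 (fun q => in_chi q.1.1.1)) => //.
apply: computable_rescale; last exact: computableT_last1.
- exact/with_E2_ext/with_E2_window.
- exact: (@computable_nvar _ _ 2).
- exact: (@computable_nvar _ _ 1).
Qed.

Lemma computableT_slice_indic (R : realType) :
  @computableT tyRR _ (window_ctx R) (@slice_indic R).
Proof.
rewrite /= /slice_indic; wk; apply: computable_rat_code.
- exact: computable_slice_chi.
- exact: computable_const.
- exact: computable_const.
Qed.

Lemma computableT_normalize (R : realType) (P : Type) (A : ctx P)
    (alpha : P -> total_obj ty1) :
  with_E2 A -> computableT A alpha ->
  @computableT ty1 _ A (fun p => normalize R (alpha p)).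
Proof.
move=> HA Ha; apply: computable_if => //; last exact: computable_const.
by have := decidable_in_wk Base (decidable_in_fast_cauchy R HA Ha).
Qed.

Lemma computable_slice_modulus (R : realType) :
  computable (ext ty1 (window_ctx R)) (fun q => slice_modulus q.1 q.2).
Proof.
have HA := with_E2_ext ty1 (with_E2_window R).
apply: (@computable_app tyRR (ty1 ~~> Base ~~> Base) _ _ 5 (fun q => in_M q.1.1.1)) => //.
apply: (@applicable_cons tyRR (ty1 ~~> Base ~~> Base) _ _ _ (fun q => slice_indic q.1)).
  exact: (computableT_weaken ty1 (@computableT_slice_indic R)).
apply: (@applicable_cons ty1 (Base ~~> Base) _ _ _ (fun q => normalize R q.2)).
  by apply: computableT_normalize => //; exact: computableT_last1.
apply: (@applicable_cons Base Base _ _ _ (fun=> 0%N)); first exact: computable_const.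
apply: applicable_nil => q.
by have [F [_ MS _]] := slice_modulusP q.1.
Qed.

Lemma decidable_in_punctured (R : realType) :
  decidable_in (ext ty1 (window_ctx R)) (fun q => in_punctured q.1 q.2).
Proof.
have HA := with_E2_ext ty1 (with_E2_window R).
have Hl := computableT_last1 (window_ctx R).
have H0 : computableR (ext ty1 (window_ctx R)) (fun=> 0 : R).
  exact: (computableR_nat R (computable_const _ 0)).
have H1 : computableR (ext ty1 (window_ctx R)) (fun=> 1 : R).
  exact: (computableR_nat R (computable_const _ 1)).
have := decidable_in_and (decidable_in_gt HA Hl H0) (decidable_in_and
  (decidable_in_lt HA Hl H1) (decidable_in_eq0 (computable_slice_chi R))).
by apply: eq_decidable_in => q; rewrite /in_punctured; split=> [[? []]|[]].
Qed.

Lemma computableT_punctured_char (R : realType) :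
  @computableT ty2 _ (window_ctx R) (@punctured_char R).
Proof.
by apply: computable_if; [exact: decidable_in_punctured|exact: computable_const|
  exact: computable_const].
Qed.

Lemma computable_name_radius_exponent (R : realType) :
  computable (ext ty1 (window_ctx R)) (fun q => name_radius_exponent q.1 q.2).
Proof.
have HA := with_E2_ext ty1 (with_E2_window R).
have HA1 := with_E2_ext Base HA.
apply: computable_least => //.
have Hl := computableT_weaken Base (computableT_last1 (window_ctx R)).
have Hm := computable_last (ext ty1 (window_ctx R)).
have Hp := computableR_pow R Hm.
have H1 : computableR (ext Base (ext ty1 (window_ctx R))) (fun=> 1 : R).
  exact: (computableR_nat R (computable_const _ 1)).
have HF : computable (ext Base (ext ty1 (window_ctx R)))
    (fun q => slice_modulus q.1.1 q.1.2).
  by wk; exact: computable_slice_modulus.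
have := decidable_in_and (decidable_in_le HF Hm) (decidable_in_and
  (decidable_in_gt HA1 Hl Hp) (decidable_in_lt HA1 Hl (computableR_sub HA1 H1 Hp))).
by apply: eq_decidable_in => q; split=> [[? []]|[]].
Qed.

Lemma computableT_punctured_radius (R : realType) :
  @computableT tyRR _ (window_ctx R) (@punctured_radius R).
Proof.
rewrite /= /punctured_radius; wk; apply: computable_if.
- exact: decidable_in_punctured.
- by apply: computable_rat_code_pow; exact: computable_name_radius_exponent.
- exact: computable_const.
Qed.

(** The three added numbers are the exponent k, the rational code c and the interval number n
    quantified in [slice_hit]; the place m in the name is the bound argument. *)
Lemma computableT_punctured_code (R : realType) i : (i <= 1)%N ->
  @computableT ty1 _ (ext Base (ext Base (ext Base (window_ctx R))))
    (fun q => punctured_code q.1.1.1 i q.2).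
Proof.
move=> i1; set A := ext Base (ext Base (ext Base (window_ctx R))).
have wk4 t g := fun H => computableT_weaken Base (computableT_weaken Base
  (computableT_weaken Base (computableT_weaken Base
  (H : @computableT t _ (window_ctx R) g)))).
have HA : with_E2 (ext Base A) by do 4 apply: with_E2_ext; exact: with_E2_window.
apply: (@computable_app ty2 (tyRR ~~> ty2 ~~> Base ~~> Base ~~> Base ~~> Base)
  _ _ 7 (fun q => in_Delta q.1.1.1.1.1.1)) => //.
apply: (@applicable_cons ty2 (tyRR ~~> ty2 ~~> Base ~~> Base ~~> Base ~~> Base)
  _ _ _ (fun q => punctured_char q.1.1.1.1)).
  exact: (wk4 _ _ (@computableT_punctured_char R)).
apply: (@applicable_cons tyRR (ty2 ~~> Base ~~> Base ~~> Base ~~> Base)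
  _ _ _ (fun q => punctured_radius q.1.1.1.1)).
  exact: (wk4 _ _ (@computableT_punctured_radius R)).
apply: (@applicable_cons ty2 (Base ~~> Base ~~> Base ~~> Base) _ _ _ (fun=> E2)).
  exact: computableT_E2.
apply: (@applicable_cons Base (Base ~~> Base ~~> Base) _ _ _ (fun=> i)).
  exact: computable_const.
apply: (@applicable_cons Base (Base ~~> Base) _ _ _ (fun q => q.1.2)).
  exact: (@computable_nvar _ _ 1).
apply: (@applicable_cons Base Base _ _ _ (fun q => q.2)).
  exact: computable_last.
apply: applicable_nil => q.
by have [a [b [_ _ H]]] := punctured_codeP q.1.1.1.1; exact: H.
Qed.

Lemma decidable_in_slice_hit (R : realType) :
  decidable_in (window_ctx R) (@slice_hit R).
Proof.
have HA := with_E2_window R; have HA1 := with_E2_ext Base HA.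
have HA2 := with_E2_ext Base HA1; have HA3 := with_E2_ext Base HA2.
apply: decidable_in_not; apply: decidable_in_ex => //.
apply: decidable_in_all => //; apply: decidable_in_imply.
  have Hc := computableR_code R (computable_last (ext Base (window_ctx R))).
  have Hq : computableR (ext Base (ext Base (window_ctx R))) (fun=> 2 ^- 2 : R).
    exact: (computableR_pow R (computable_const _ 2)).
  have H1 : computableR (ext Base (ext Base (window_ctx R))) (fun=> 1 : R).
    exact: (computableR_nat R (computable_const _ 1)).
  have := decidable_in_and (decidable_in_leR HA2 Hq Hc)
    (decidable_in_leR HA2 Hc (computableR_sub HA2 H1 Hq)).
  by apply: eq_decidable_in => q; split=> [[? ?]|/andP[]//]; apply/andP.
apply: decidable_in_ex => //.
have Hk : computableR (ext Base (ext Base (ext Base (window_ctx R))))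
    (fun q => 2 ^- q.1.1.2 : R).
  by apply: computableR_pow; exact: (@computable_nvar _ _ 2).
have Hc : computableR (ext Base (ext Base (ext Base (window_ctx R))))
    (fun q => rat_of_code R q.1.2).
  by apply: computableR_code; exact: (@computable_nvar _ _ 1).
apply: decidable_in_and.
  apply: (decidable_in_lt HA3 (computableT_punctured_code R (leq0n 1))).
  exact: computableR_sub.
apply: (decidable_in_gt HA3 (computableT_punctured_code R (leqnn 1))).
exact: computableR_add.
Qed.

Lemma computable_omega_name (R : realType) :
  computable (ext Base (input_ctx R)) (fun q => omega_name q.1 q.2).
Proof.
apply: computable_least; first by exists 4.
by apply: eq_decidable_in (@decidable_in_slice_hit R) => -[[]].
Qed.

Theorem theorem2p10 (R : realType) :
  exists e : nat, forall (Delta : partial_obj tyDelta) (M : partial_obj tyMBV),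
    is_Delta R Delta -> is_MBV R M -> computes_Omega R e Delta M.
Proof.
have [e He] := computable_omega_name R; exists e => Delta M HD HM X chi X1 chiX.
pose p := Input HD HM X1 chiX.
by exists (omega_name p); split=> [|n]; [exact: (omega_nameP p)|exact: (He (p, n))].
Qed.
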